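(* Let $n\ge2$ be an integer. Let $a_{k,j}$ ($0\le j\le k\le n$) be the coefficients of $p(k,x)=\sum_{j=0}^{k}a_{k,j}x^j$. Let $m=n-1$ if $n$ is odd and $m=n$ if $n$ is even. Define $\alpha_m,\alpha_{m-2},\dots,\alpha_0$ by $$\alpha_m=-\frac{4}{\pi}c_{n,m}a_{m,0},\qquad \alpha_{m-2i}=\frac{(m-2i+2)\alpha_{m-2i+2}}{2}-\frac{4}{\pi}c_{n,m-2i}a_{m-2i,0}\ \ \Big(i\in\{1,\dots,\tfrac m2-1\}\Big),\qquad \alpha_0=\alpha_2-\frac{4}{\pi}c_{n,0}a_{0,0},$$ and $\beta_{2n},\beta_{2n-2},\dots,\beta_0$ by $$\beta_{2n}=-\frac{2}{\pi}(-1)^n c_{n,n}a_{n,n},\qquad \beta_{2n-2i}=\frac{(n-i+1)\beta_{2n-2i+2}}{2}-\frac{2}{\pi}\sum_{k=n-i}^{\min\{2n-2i,\,n\}}(-1)^k c_{n,k}a_{k,2(n-i)-k}\ \ (i\in\{1,\dots,n-1\}),$$ $$\beta_0=\frac{\beta_2}{2}-\frac{2}{\pi}c_{n,0}a_{0,0}.$$ Set $p_{n,1}(x)=\alpha_0+\alpha_2x^2+\dots+\alpha_mx^m$, $p_{n,2}(x)=\beta_0+\beta_2x^2+\dots+\beta_{2n}x^{2n}$, $p_{n,0}=-(\alpha_0+\beta_0)$, and for $x\ge0$ $$f_n(x)=\sqrt{p_{n,0}+p_{n,1}(x)e^{-x^2}+p_{n,2}(x)e^{-2x^2}}.$$ Then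 $\lim_{n\to\infty}f_n(x)=\operatorname{erf}(x)$ for $x\ge0$, and the convergence is uniform on $[0,\infty)$.
   Context: $\operatorname{erf}(x)=\frac{2}{\sqrt{\pi}}\int_0^x e^{-\lambda^2}\,d\lambda$. For integers $0\le k\le n$, $c_{n,k}=\frac{n!}{(n-k)!\,(k+1)!}\cdot\frac{(2n+1-k)!}{2\,(2n+1)!}$. The polynomials $p(k,x)$ are defined recursively by $p(0,x)=1$ and $p(k,x)=\frac{d}{dx}p(k-1,x)-2x\,p(k-1,x)$ for $k\ge1$. *)

(* Defs.v *)
From HB Require Import structures.
From mathcomp Require Import all_boot all_order all_algebra.
From mathcomp Require Import all_classical all_reals all_analysis.
Set Implicit Arguments. Unset Strict Implicit. Unset Printing Implicit Defensive.
Import Order.TTheory GRing.Theory Num.Theory.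
Import numFieldNormedType.Exports.
Local Open Scope classical_set_scope.
Local Open Scope ring_scope.

Section Defs.
Variable R : realType.

Definition erf (x : R) : R :=
  2 / Num.sqrt pi * \int[lebesgue_measure]_(l in `[0, x]) expR (- l ^+ 2).

Definition cnk (n k : nat) : R :=
  (n`!)%:R / ((n - k)`!%:R * (k.+1)`!%:R) *
  ((2 * n + 1 - k)`!)%:R / (2 * ((2 * n + 1)`!)%:R).

Fixpoint hp (k : nat) : {poly R} :=
  if k is k'.+1 then (hp k')^`() - 2%:P * 'X * hp k' else 1.

Definition acoef (k j : nat) : R := (hp k)`_j.

Definition mdeg (n : nat) : nat := if odd n then n.-1 else n.

(* alphaAux n i = alpha_{m-2i}, i = 0 .. m/2 *)
Fixpoint alphaAux (n i : nat) : R :=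
  let m := mdeg n in
  match i with
  | 0 => - (4 / pi) * cnk n m * acoef m 0
  | i'.+1 =>
      ((m - 2 * i')%:R * alphaAux n i') / 2
      - (4 / pi) * cnk n (m - 2 * i) * acoef (m - 2 * i) 0
  end.

(* alpha n j = alpha_{2j}, j = 0 .. m/2 *)
Definition alpha (n j : nat) : R := alphaAux n ((mdeg n)./2 - j).

Definition betaSum (n i : nat) : R :=
  \sum_(n - i <= k < (minn (2 * n - 2 * i) n).+1)
     (-1) ^+ k * cnk n k * acoef k (2 * (n - i) - k).

(* betaAux n i = beta_{2n-2i}, i = 0 .. n *)
Fixpoint betaAux (n i : nat) : R :=
  match i with
  | 0 => - (2 / pi) * (-1) ^+ n * cnk n n * acoef n n
  | i'.+1 => ((n - i')%:R * betaAux n i') / 2 - (2 / pi) * betaSum n i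
  end.

(* beta n j = beta_{2j}, j = 0 .. n *)
Definition beta (n j : nat) : R := betaAux n (n - j).

Definition pn1 (n : nat) (x : R) : R :=
  \sum_(j < (mdeg n)./2.+1) alpha n j * x ^+ (2 * j).
Definition pn2 (n : nat) (x : R) : R :=
  \sum_(j < n.+1) beta n j * x ^+ (2 * j).
Definition pn0 (n : nat) : R := - (alpha n 0 + beta n 0).

Definition fn (n : nat) (x : R) : R :=
  Num.sqrt (pn0 n + pn1 n x * expR (- x ^+ 2) + pn2 n x * expR (- (2 * x ^+ 2))).

End Defs.

(* Main.v *)
(* Put S_n(t) = sum_k c_{n,k} t^(k+1) (g_k(0) + (-1)^k g_k(t)), where
   g_k(t) = p(k,t) e^(-t^2) is the k-th derivative of g = e^(-t^2).  This is
   Hermite's two-point Taylor rule for G(t) = int_0^t g: integrating by parts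
   against the kernel (s(t-s))^(n+1) bounds |G(t) - S_n(t)| by
   t (t^2/4)^(n+1) / (2n+2)! times the maximum of |g_(2n+2)|, which is
   (2n+2)!/(n+1)!.
   The recursions for alpha and beta say exactly that the radicand F_n of f_n
   satisfies F_n(0) = 0 and F_n' = (8/pi) g S_n, whereas
   (erf^2)' = (8/pi) g G.  Hence |F_n' - (erf^2)'| is at most
   (8/pi) 4^-(n+1) t^(2n+3) g(t) / (n+1)!, whose antiderivative is explicit and
   bounded by (4/pi) 4^-(n+1).  Finally |sqrt a - sqrt b| <= sqrt |a - b|. *)
Require Import Defs.
From HB Require Import structures.
From mathcomp Require Import all_boot all_order all_algebra.
From mathcomp Require Import zify ring lra.
From mathcomp Require Import all_classical all_reals all_analysis.
Import Order.TTheory GRing.Theory Num.Theory.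
Import numFieldNormedType.Exports.
Local Open Scope classical_set_scope.
Local Open Scope ring_scope.

Set Implicit Arguments.
Unset Strict Implicit.

(** * Monotonicity from derivatives, and derivatives of polynomials times Gaussians *)

Section Derivatives.
Variable R : realType.
Implicit Types (x t : R) (p K : {poly R}).

Lemma le0_increment (f f' : R -> R) t : 0 <= t ->
  {within `[0, t], continuous f} ->
  (forall x, 0 < x < t -> is_derive x 1 f (f' x)) ->
  (forall x, 0 < x < t -> 0 <= f' x) -> f 0 <= f t.
Proof.
move=> t0 cf df f'0; apply: (@ger0_derive1_le_cc R f 0 t) => //.
- by move=> x; rewrite in_itv/= => /df[].
- by move=> x; rewrite in_itv/= derive1E => xt; have [_ ->] := df _ xt; exact: f'0.
- by rewrite in_itv/= lexx.
- by rewrite in_itv/= lexx t0.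
Qed.

(** Monotonicity of g - f and of g + f gives the two signs. Derivatives are asked only inside (0, t)
    because [gauss_int] is not differentiable at 0. *)
Lemma norm_increment_le (f g f' g' : R -> R) t : 0 <= t ->
  {within `[0, t], continuous f} -> {within `[0, t], continuous g} ->
  (forall x, 0 < x < t -> is_derive x 1 f (f' x)) ->
  (forall x, 0 < x < t -> is_derive x 1 g (g' x)) ->
  (forall x, 0 < x < t -> `|f' x| <= g' x) ->
  `|f t - f 0| <= g t - g 0.
Proof.
move=> t0 cf cg df dg fg.
have h1 : (g - f) 0 <= (g - f) t.
  apply: (le0_increment (f' := fun x => g' x - f' x)) => //.
  - by move=> x; exact: (cvgB (cg x) (cf x)).
  - by move=> x xt; apply: is_deriveB; [exact: dg|exact: df].
  - by move=> x /fg; rewrite ler_norml subr_ge0 => /andP[].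
have h2 : (g + f) 0 <= (g + f) t.
  apply: (le0_increment (f' := fun x => g' x + f' x)) => //.
  - by move=> x; exact: (cvgD (cg x) (cf x)).
  - by move=> x xt; apply: is_deriveD; [exact: dg|exact: df].
  - by move=> x /fg; rewrite ler_norml => /andP[]; lra.
by move: h1 h2; rewrite !fctE ler_norml => h1 h2; apply/andP; split; lra.
Qed.

Lemma derive_within_continuous (f f' : R -> R) (A : interval R) :
  (forall x, is_derive x 1 f (f' x)) -> {within [set` A], continuous f}.
Proof. by move=> df; apply: derivable_within_continuous => x _; case: (df x). Qed.

Lemma is_derive_poly_gauss p (c x : R) :
  is_derive x 1 (fun y => p.[y] * expR (- (c * y ^+ 2)))
    ((p^`() - (2 * c)%:P * 'X * p).[x] * expR (- (c * x ^+ 2))).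
Proof.
pose q : {poly R} := - (c%:P * 'X^2).
have -> : (fun y => p.[y] * expR (- (c * y ^+ 2))) = horner p * (expR \o horner q).
  by apply/funext => y; rewrite fctE /= /q !hornerE.
apply: is_derive_eq; rewrite /q /= !(derivN, derivM, derivC, derivX) !hornerE /=.
rewrite /GRing.scale /=; ring.
Qed.

End Derivatives.

(** * Hermite recurrence, parity and degree of p(k,x) *)

Section Hermite.
Variable R : realType.
Implicit Types (x t : R) (p K : {poly R}).

Definition gaussD k x : R := (hp R k).[x] * expR (- x ^+ 2).

Lemma is_derive_gaussD k x : is_derive x 1 (gaussD k) (gaussD k.+1 x).
Proof.
have -> : gaussD k = fun y => (hp R k).[y] * expR (- (1 * y ^+ 2)).
  by apply/funext => y; rewrite mul1r.
by have := is_derive_poly_gauss (hp R k) 1 x; rewrite mulr1 !mul1r.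
Qed.

(** Hermite three-term recurrence, that is u'' + 2xu' + 2(k+1)u = 0 for u = g_k. The induction step
    differentiates it and removes derivatives through the definition of [hp]. *)
Lemma hpSS k :
  hp R k.+2 = - (2%:P * 'X * hp R k.+1 + (2 * k.+1%:R)%:P * hp R k).
Proof.
have hpS j : hp R j.+1 = (hp R j)^`() - 2%:P * 'X * hp R j by [].
elim: k => [|k IH]; first rewrite /= !mulr1 -!polyC1 !(derivB, derivM, derivC, derivX).
  by ring.
rewrite [LHS]hpS [in X in X^`()]IH derivN derivD !derivM !derivC derivX.
have -> : (hp R k.+1)^`() = hp R k.+2 + 2%:P * 'X * hp R k.+1.
  by rewrite [hp R k.+2]hpS subrK.
have -> : (hp R k)^`() = hp R k.+1 + 2%:P * 'X * hp R k by rewrite hpS subrK.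
have -> : k.+2%:R = k.+1%:R + 1 :> R by rewrite natr1.
rewrite [hp R k.+2]IH !(polyCM, polyCD).
by ring.
Qed.

Lemma coef_hpS k j : (hp R k.+1)`_j =
  (hp R k)`_j.+1 *+ j.+1 - 2 * (if j is j'.+1 then (hp R k)`_j' else 0).
Proof.
rewrite /= coefB coef_deriv -mulrA coefCM coefXM.
by case: j.
Qed.

Lemma hp_parity k j : odd (k + j) -> (hp R k)`_j = 0.
Proof.
elim: k j => [|k IH] j; first by rewrite coefC; case: j.
rewrite addSn /= => kj; rewrite coef_hpS IH ?addnS// mul0rn.
case: j kj => [|j] kj; rewrite ?IH ?mulr0 ?subr0//.
by move: kj; rewrite addnS /= negbK.
Qed.

Lemma hp_gt k j : (k < j)%N -> (hp R k)`_j = 0.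
Proof.
elim: k j => [|k IH] j; first by rewrite coefC; case: j.
case: j => // j kj; rewrite coef_hpS !IH ?mul0rn ?mulr0 ?subr0//.
exact: ltnW (ltnW kj).
Qed.

End Hermite.

(** * Maximum of the even derivatives of the Gaussian *)

Section Energy.
Variable R : realType.
Implicit Types (x t : R).

Lemma gaussDSS k x :
  gaussD k.+2 x = - (2 * x * gaussD k.+1 x + 2 * k.+1%:R * gaussD k x).
Proof.
rewrite /gaussD hpSS; move: (hp R k.+1) (hp R k) (k.+1%:R) => p q c.
by rewrite !(hornerN, hornerD, hornerM, hornerC, hornerX); ring.
Qed.

Lemma gaussD0_odd k : odd k -> gaussD k 0 = 0 :> R.
Proof. by move=> ok; rewrite /gaussD horner_coef0 hp_parity ?mul0r ?addn0. Qed.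

(** At 0 [gaussDSS] reduces to g_(k+2)(0) = -2(k+1) g_k(0), and these factors multiply up to
    (2m)!/m! in absolute value. *)
Lemma gaussD0_even m : `|gaussD m.*2 0 : R| * m`!%:R = (m.*2)`!%:R.
Proof.
elim: m => [|m IH]; first by rewrite /gaussD !hornerE expr0n /= oppr0 expR0 normr1.
rewrite doubleS gaussDSS mulr0 mul0r add0r normrN normrM ger0_norm; last first.
  by rewrite mulr_ge0.
rewrite !factS !natrM -IH -mul2n -!natr1 natrM.
ring.
Qed.

(* The energy u'^2 + 2(k+1)u^2 of a solution u of u'' + 2xu' + 2(k+1)u = 0 is
   nonincreasing for x >= 0, so an even derivative of the Gaussian is largest
   in absolute value at 0. *)
Lemma gaussD_even_le m t : 0 <= t -> `|gaussD m.*2 t| <= `|gaussD m.*2 0|.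
Proof.
move=> t0; set k := m.*2.
pose E x : R := - (gaussD k.+1 x ^+ 2 + 2 * k.+1%:R * gaussD k x ^+ 2).
pose E' x : R := 4 * x * gaussD k.+1 x ^+ 2.
have dE x : is_derive x 1 E (E' x).
  have d0 := is_derive_gaussD k x; have d1 := is_derive_gaussD k.+1 x.
  have -> : E = - (gaussD k.+1 ^+ 2 + (2 * k.+1%:R) \*: (gaussD k ^+ 2)).
    by apply/funext => y; rewrite /E !fctE.
  apply: is_derive_eq; rewrite gaussDSS /E' /GRing.scale /=.
  ring.
have : E 0 <= E t.
  apply: (le0_increment (f' := E')) => //.
  - exact: derive_within_continuous dE.
  - by move=> x /andP[x0 _]; rewrite /E' mulr_ge0 ?sqr_ge0// mulr_ge0// ltW.
(* An odd derivative vanishes at 0, so the energy there is its u^2 term alone; at t the u'^2 term is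
   dropped. *)
rewrite /E lerN2 gaussD0_odd ?expr0n/= ?add0r /k ?odd_double// => le.
have {le} : 2 * k.+1%:R * gaussD k t ^+ 2 <= 2 * k.+1%:R * gaussD k 0 ^+ 2.
  by apply: le_trans le; rewrite lerDr sqr_ge0.
by rewrite ler_pM2l ?mulr_gt0// -real_normK ?num_real//
  -[X in _ <= X]real_normK ?num_real// ler_sqr ?nnegrE.
Qed.

Lemma gaussD_even_bound m t : 0 <= t ->
  `|gaussD m.*2 t| <= (m.*2)`!%:R / m`!%:R.
Proof.
move=> t0; rewrite (le_trans (gaussD_even_le m t0))//.
by rewrite ler_pdivlMr ?gaussD0_even ?ltr0n ?fact_gt0.
Qed.

End Energy.

(** * Hermite's two-point Taylor formula with remainder bound *)

Section TwoPointTaylor.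
Variable R : realType.
Implicit Types (x t : R) (K : {poly R}).

(* Boundary terms of N integrations by parts of K^(N) f_0. *)
Definition parts K N (f : nat -> R -> R) : R -> R :=
  fun x => \sum_(j < N) (-1) ^+ j * K^`(N - j.+1).[x] * f j x.

(** The sum telescopes. The induction runs over all K, since passing from N to N+1 replaces K by
    K'. *)
Lemma is_derive_parts K N (f : nat -> R -> R) x :
  (forall k (y : R), is_derive y 1 (f k) (f k.+1 y)) ->
  is_derive x 1 (parts K N f) (K^`(N).[x] * f 0 x - (-1) ^+ N * K.[x] * f N x).
Proof.
move=> df; elim: N K => [|N IH] K.
  have -> : parts K 0 f = cst 0 by apply/funext => y; rewrite /parts big_ord0.
  by apply: is_derive_eq; rewrite derivn0 expr0 mul1r subrr.
have -> : parts K N.+1 f = parts K^`() N f + ((-1) ^+ N \*: (horner K * f N)).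
  apply/funext => y; rewrite /parts big_ord_recr /= !fctE subnn derivn0 -mulrA.
  congr (_ + _); apply: eq_bigr => j _.
  by rewrite subSS -derivSn -subSn.
have := IH K^`() => dp; apply: is_derive_eq.
rewrite -derivSn exprS /GRing.scale /=; ring.
Qed.

(** The zeros of order n at 0 and t remove half of the boundary terms; the symmetry ties derivatives
    at t to those at 0. *)
Definition kern n t : {poly R} := ('X * (t%:P - 'X)) ^+ n.

(** The reflection X -> t - X fixes the kernel, and each derivative brings out a factor -1. *)
Lemma derivn_kern_sym n t i : (kern n t)^`(i).[t] = (-1) ^+ i * (kern n t)^`(i).[0].
Proof.
have sym p : p \Po (t%:P - 'X) = p -> forall j,
    p^`(j) \Po (t%:P - 'X) = (-1) ^+ j *: p^`(j).
  move=> ps; elim=> [|j IH]; first by rewrite derivn0 expr0 scale1r.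
  have := congr1 (@deriv R) IH; rewrite deriv_comp derivZ -derivnS.
  rewrite derivB derivC derivX sub0r mulrN1 => /eqP; rewrite eqr_oppLR => /eqP ->.
  by rewrite exprS mulN1r scaleNr.
have /sym/(_ i)/(congr1 (fun p => p.[0])) : kern n t \Po (t%:P - 'X) = kern n t.
  rewrite /kern rmorphXn /= rmorphM /= comp_polyX.
  by rewrite rmorphB /= comp_polyC comp_polyX subKr mulrC.
by rewrite horner_comp hornerZ !hornerE subr0.
Qed.

Lemma coef_subX_exp n t i :
  ((t%:P - 'X) ^+ n)`_i = (-1) ^+ i * t ^+ (n - i) *+ 'C(n, i).
Proof.
have -> : (t%:P - 'X) ^+ n =
    \poly_(j < n.+1) ((-1) ^+ j * t ^+ (n - j) *+ 'C(n, j)).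
  rewrite exprDn poly_def; apply: eq_bigr => j _.
  rewrite -mul_polyC polyCMn polyCM !polyC_exp polyCN polyC1 (exprNn 'X).
  by rewrite mulrnAl mulrCA mulrA.
by rewrite coef_poly ltnS; case: leqP => // /bin_small ->.
Qed.

Lemma coef_kern_lt n t i : (i < n)%N -> (kern n t)`_i = 0.
Proof. by rewrite /kern exprMn coefXnM => ->. Qed.

Lemma coef_kern n t i :
  (kern n t)`_(n + i) = (-1) ^+ i * t ^+ (n - i) *+ 'C(n, i).
Proof. by rewrite /kern exprMn coefXnM ltnNge leq_addr addKn coef_subX_exp. Qed.

Lemma derivn_kern_top n t : (kern n t)^`(n.*2) = ((-1) ^+ n * (n.*2)`!%:R)%:P.
Proof.
apply/polyP => i; rewrite coef_derivn coefC -addnn -addnA coef_kern.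
case: i => [|i]; first by rewrite addn0 binn subnn mulr1 mulr_natr ffactnn.
by rewrite bin_small ?mulr0n ?mul0rn// addnS ltnS leq_addr.
Qed.

Lemma kern_bound n t x : 0 <= x <= t -> `|(kern n t).[x]| <= (t ^+ 2 / 4) ^+ n.
Proof.
move=> /andP[x0 xt]; rewrite /kern horner_exp !hornerE ger0_norm; last first.
  by rewrite exprn_ge0// mulr_ge0 ?subr_ge0.
have tn : 0 <= t ^+ 2 / 4 by rewrite divr_ge0 ?sqr_ge0.
rewrite lerXn2r ?nnegrE ?mulr_ge0 ?subr_ge0 ?(le_trans x0 xt)//.
by have := sqr_ge0 (t - 2 * x); rewrite ler_pdivlMr//; nra.
Qed.

(** Up to sign and a factor t^(k+1), the right side is the derivative of order 2n+1-k of
    [kern n.+1 t] at 0; this is where the c_{n,k} come from. *)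
Lemma cnk_bin n k : (k <= n)%N ->
  (n.+1.*2)`!%:R * cnk R n k = (2 * n + 1 - k)`!%:R * ('C(n.+1, n - k))%:R.
Proof.
move=> kn; rewrite /cnk.
have binE : 'C(n.+1, n - k)%:R * ((n - k)`!%:R * (k.+1)`!%:R) =
    n.+1%:R * n`!%:R :> R.
  rewrite -!natrM -factS -(@bin_fact n.+1 (n - k)); last by lia.
  by rewrite subSn ?leq_subr// subKn.
have -> : (n.+1.*2)`!%:R = n.+1%:R * (2 * (2 * n + 1)`!%:R) :> R.
  rewrite doubleS factS (_ : n.*2.+1 = 2 * n + 1)%N; last by lia.
  by rewrite mulrA -!natrM; congr (_ * _)%:R; lia.
have h0 j : (j`!)%:R != 0 :> R by rewrite pnatr_eq0 -lt0n fact_gt0.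
apply: (@mulIf _ ((n - k)`!%:R * (k.+1)`!%:R)); first by rewrite mulf_neq0.
rewrite -[RHS]mulrA binE.
move: (h0 (n - k)%N) (h0 k.+1) (h0 (2 * n + 1)%N).
move: (n - k)`!%:R (k.+1)`!%:R (2 * n + 1)`!%:R n.+1%:R n`!%:R => a b c d e.
by move=> a0 b0 c0; field; rewrite a0 b0 c0.
Qed.

(** Here [f] lists a function and its successive derivatives; for [gaussD] this is S_n(t). *)
Definition quad n (f : nat -> R -> R) t : R :=
  \sum_(k < n.+1) cnk R n k * t ^+ k.+1 * (f k 0 + (-1) ^+ k * f k t).

Lemma parts_kern n (f : nat -> R -> R) t :
  parts (kern n.+1 t) n.+1.*2 f t - parts (kern n.+1 t) n.+1.*2 f 0 =
  (-1) ^+ n.+1 * (n.+1.*2)`!%:R * quad n f t.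
Proof.
(* For j > n the kernel is differentiated at most n times, fewer than the order n+1 of its zeros, so
   only the terms j <= n remain. *)
rewrite /parts /quad -sumrB -addnn big_split_ord /= [X in _ + X]big1 ?addr0.
  rewrite mulr_sumr; apply: eq_bigr => k _.
  have kn : (k <= n)%N by rewrite -ltnS ltn_ord.
  rewrite derivn_kern_sym horner_coef0 coef_derivn addn0 ffactnn.
  have -> : (n.+1 + n.+1 - k.+1 = n.+1 + (n - k))%N.
    by lia.
  rewrite coef_kern addnn subSn ?leq_subr// subKn// exprD.
  have Ei : (n.+1 + (n - k) = 2 * n + 1 - k)%N by lia.
  have := cnk_bin kn; rewrite -Ei => cE.
  (* All signs are written through a = (-1)^k and b = (-1)^(n-k), with a^2 = b^2 = 1 as rewriting
     rules for [ring]. *)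
  have aa : (-1) ^+ k * (-1) ^+ k = 1 :> R by rewrite -expr2 sqrr_sign.
  have bb : (-1) ^+ (n - k) * (-1) ^+ (n - k) = 1 :> R by rewrite -expr2 sqrr_sign.
  have ab : (-1) ^+ n.+1 = - ((-1) ^+ (n - k) * (-1) ^+ k) :> R.
    by rewrite -exprD subnK// exprS mulN1r.
  have natE (y : R) : y *+ 'C(n.+1, n - k) *+ (n.+1 + (n - k))`! =
      y * ((n.+1.*2)`!%:R * cnk R n k).
    by rewrite cE -mulrnA -[LHS]mulr_natr mulnC natrM.
  rewrite natE ab; move: ((-1) ^+ k) ((-1) ^+ (n - k)) aa bb => a b aa bb.
  move: (n.+1.*2)`!%:R (cnk R n k) (t ^+ k.+1) (f k 0) (f k t) => g c u v w.
  ring: aa bb.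
move=> k _; rewrite derivn_kern_sym horner_coef0 coef_derivn coef_kern_lt.
  by rewrite mul0rn mulr0 mulr0 !mul0r subrr.
by rewrite addn0; have := ltn_ord k; lia.
Qed.

Lemma two_point_taylor n (f : nat -> R -> R) (E : R -> R) (M t : R) :
  0 <= t -> (forall k (x : R), is_derive x 1 (f k) (f k.+1 x)) ->
  {within `[0, t], continuous E} ->
  (forall x, 0 < x < t -> is_derive x 1 E (f 0 x)) ->
  (forall x, 0 < x < t -> `|f n.+1.*2 x| <= M) ->
  `|E t - E 0 - quad n f t| <= M * t * (t ^+ 2 / 4) ^+ n.+1 / (n.+1.*2)`!%:R.
Proof.
move=> t0 df cE dE fM; set c : R := (n.+1.*2)`!%:R.
have c0 : 0 < c by rewrite ltr0n fact_gt0.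
set K := kern n.+1 t; set e : R := (-1) ^+ n.+1.
(* The derivative of order 2n+2 of the kernel is the constant e c, so D' is K f_(2n+2) alone. *)
pose D := e * c \*: E - parts K n.+1.*2 f.
pose G x := M * (t ^+ 2 / 4) ^+ n.+1 * x.
have dP x := is_derive_parts K n.+1.*2 x df.
have : `|D t - D 0| <= G t - G 0.
  apply: (@norm_increment_le _ D G (fun x => K.[x] * f n.+1.*2 x)
            (fun=> M * (t ^+ 2 / 4) ^+ n.+1)) => //.
  - move=> x; apply: (cvgB (cvgZ (cvg_cst (e * c)) (cE x))).
    exact: (derive_within_continuous (A := `[0, t]) dP).
  - apply: (derive_within_continuous (f' := fun=> M * (t ^+ 2 / 4) ^+ n.+1)) => x.
    by apply: is_derive_eq; rewrite /GRing.scale /=; ring.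
  - move=> x /dE dEx; have dPx := dP x; apply: is_derive_eq.
    rewrite /K derivn_kern_top -/K hornerC -(signr_odd _ n.+1.*2) odd_double.
    rewrite expr0 mul1r /GRing.scale /=.
    by rewrite -/c -/e; ring.
  - move=> x _; apply: is_derive_eq; rewrite /GRing.scale/=; ring.
  - move=> x xt; rewrite normrM mulrC ler_pM ?fM ?kern_bound//.
    by case/andP: xt => /ltW -> /ltW ->.
rewrite /D /G !fctE /GRing.scale /= mulr0 subr0 => le.
rewrite ler_pdivlMr//; apply: le_trans (le_trans le _); last first.
  by rewrite le_eqVlt; apply/orP; left; apply/eqP; ring.
set p1 := parts _ _ _ t; set p0 := parts _ _ _ 0.
have -> : e * c * E t - p1 - (e * c * E 0 - p0) =
    e * c * (E t - E 0) - (p1 - p0) by ring.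
rewrite parts_kern -/e -/c -mulrBr -mulrA normrM normr_sign mul1r normrM.
by rewrite (ger0_norm (ltW c0)) mulrC.
Qed.

End TwoPointTaylor.

(** * The Gaussian integral and its two-point approximation *)

Section GaussIntegral.
Variable R : realType.
Implicit Types (x t : R).

Definition gauss_int x : R := \int[lebesgue_measure]_(l in `[0, x]) expR (- l ^+ 2).

Lemma integrable_gauss_segment t :
  lebesgue_measure.-integrable `[0, t] (EFin \o @gauss_fun R).
Proof.
apply: continuous_compact_integrable => //; first exact: segment_compact.
by apply: continuous_subspaceT; exact: continuous_gauss_fun.
Qed.

Lemma gauss_int_continuous t : 0 <= t -> {within `[0, t], continuous gauss_int}.
Proof.
move=> t0; apply: parameterized_integral_continuous => //.
exact: integrable_gauss_segment.
Qed.

Lemma is_derive_gauss_int x : 0 < x -> is_derive x 1 gauss_int (gaussD 0 x).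
Proof.
(* The endpoint x + 1 serves to make x interior to the interval of integration. *)
move=> x0; have x1 : x < x + 1 by rewrite ltrDl.
have [] := continuous_FTC1_closed x1 (integrable_gauss_segment (x + 1)) x0
  (@continuous_gauss_fun R x).
rewrite derive1E /gaussD hornerC mul1r => d e.
exact: DeriveDef.
Qed.

Lemma gauss_int0 : gauss_int 0 = 0.
Proof. by rewrite /gauss_int set_itv1 Rintegral_set1. Qed.

Lemma gauss_int_ge0 x : 0 <= gauss_int x.
Proof. by apply: Rintegral_ge0 => //= y _; exact: expR_ge0. Qed.

(** With M = (2n+2)!/(n+1)! from [gaussD_even_bound], the (2n+2)! of the general error bound
    cancels. *)
Lemma gauss_int_quad n t : 0 <= t ->
  `|gauss_int t - quad n (@gaussD R) t| <= t * (t ^+ 2 / 4) ^+ n.+1 / (n.+1)`!%:R.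
Proof.
move=> t0; have := @two_point_taylor R n (@gaussD R) gauss_int
  ((n.+1.*2)`!%:R / (n.+1)`!%:R) t t0 (@is_derive_gaussD R)
  (gauss_int_continuous t0).
rewrite gauss_int0 subr0 => /(_ _ _)/le_trans; apply.
- by move=> x /andP[x0 _]; exact: is_derive_gauss_int.
- by move=> x /andP[x0 _]; apply: gaussD_even_bound; exact: ltW.
have h0 j : (j`!)%:R != 0 :> R by rewrite pnatr_eq0 -lt0n fact_gt0.
move: (h0 n.+1.*2) (h0 n.+1).
move: (n.+1.*2)`!%:R (n.+1)`!%:R ((t ^+ 2 / 4) ^+ n.+1) => a b c a0 b0.
rewrite le_eqVlt; apply/orP; left; apply/eqP; field.
by rewrite a0 b0.
Qed.

End GaussIntegral.

(** * Even polynomials as polynomials in x^2 *)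

Section EvenPolynomials.
Variable R : realType.
Implicit Types (x : R) (A Q : {poly R}).

(** In the variable y^2, differentiation acts on A as A' - cA, apart from a factor 2x. This is the
    form in which the recursions for alpha (c = 1) and beta (c = 2) are read. *)
Lemma is_derive_sqr_gauss A (c x : R) :
  is_derive x 1 (fun y => A.[y ^+ 2] * expR (- (c * y ^+ 2)))
    (2 * x * (A^`() - c *: A).[x ^+ 2] * expR (- (c * x ^+ 2))).
Proof.
have -> : (fun y => A.[y ^+ 2] * expR (- (c * y ^+ 2))) =
    (fun y => (A \Po 'X^2).[y] * expR (- (c * y ^+ 2))).
  by apply/funext => y; rewrite horner_comp !hornerE.
have dA := is_derive_poly_gauss (A \Po 'X^2) c x.
apply: is_derive_eq; rewrite deriv_comp derivXn.
by rewrite !(hornerD, hornerN, hornerM, hornerMn, hornerZ, horner_comp,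
  hornerC, hornerX, hornerXn) /=; ring.
Qed.

Lemma even_hornerE Q x : (forall i, odd i -> Q`_i = 0) ->
  Q.[x] = (even_poly Q).[x ^+ 2].
Proof.
move=> Qodd; have Q0 : odd_poly Q = 0.
  by apply/polyP => i; rewrite coef_odd_poly coef0 Qodd//= odd_double.
by rewrite -[in LHS](poly_even_odd Q) Q0 comp_poly0 mul0r addr0 horner_comp hornerXn.
Qed.

End EvenPolynomials.

(** * The radicand of f_n and its derivative *)

Section Approximant.
Variable R : realType.
Variable n : nat.
Implicit Types (x t : R).

(** Data at 0 go into [quadA], data at t without e^(-t^2) into [quadB]; one factor t is taken out so
    that both are even. *)
Definition quadA : {poly R} := \sum_(k < n.+1) (cnk R n k * acoef R k 0) *: 'X^k.
Definition quadB : {poly R} :=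
  \sum_(k < n.+1) ((-1) ^+ k * cnk R n k) *: ('X^k * hp R k).

Lemma quad_gaussD t :
  quad n (@gaussD R) t = t * (quadA.[t] + quadB.[t] * expR (- t ^+ 2)).
Proof.
rewrite /quad /quadA /quadB !horner_sum mulrDr mulr_suml !mulr_sumr -big_split /=.
apply: eq_bigr => k _; rewrite /gaussD expr0n oppr0 expR0 mulr1 horner_coef0.
by rewrite !(hornerZ, hornerM, hornerXn) exprS -/(acoef R k 0); ring.
Qed.

Lemma coef_quadA i :
  quadA`_i = if (i <= n)%N then cnk R n i * acoef R i 0 else 0.
Proof. by rewrite /quadA -(poly_def _ (fun k => cnk R n k * acoef R k 0)) coef_poly. Qed.

Lemma coef_quadB i : quadB`_i =
  \sum_(k < n.+1 | (k <= i)%N) (-1) ^+ k * cnk R n k * acoef R k (i - k).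
Proof.
rewrite coef_sum [RHS]big_mkcond; apply: eq_bigr => k _.
by rewrite coefZ coefXnM ltnNge; case: (k <= i)%N; rewrite ?mulr0//.
Qed.

Lemma quadA_odd i : odd i -> quadA`_i = 0.
Proof.
by move=> oi; rewrite coef_quadA /acoef hp_parity ?addn0// mulr0 if_same.
Qed.

Lemma quadB_odd i : odd i -> quadB`_i = 0.
Proof.
move=> oi; rewrite coef_quadB big1// => k ki.
by rewrite /acoef hp_parity ?subnKC// mulr0.
Qed.

(** The terms k < j, absent from [betaSum], vanish because 2j - k then exceeds the degree k of
    p(k,x). *)
Lemma quadB_even j : (j <= n)%N -> quadB`_j.*2 = betaSum R n (n - j).
Proof.
move=> jn; rewrite coef_quadB /betaSum subKn//.
have -> : (2 * n - 2 * (n - j) = j.*2)%N by lia.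
rewrite mul2n (big_nat_widen _ _ n.+1) ?ltnS ?geq_minr// big_geq_mkord /=.
rewrite [LHS]big_mkcond [RHS]big_mkcond; apply: eq_bigr => k _ /=.
rewrite ltnS leq_min (leq_ord k) andbT; case: leqP => //= kj.
case: leqP => //= jk; rewrite /acoef hp_gt ?mulr0//; lia.
Qed.

Definition polyA : {poly R} := \poly_(j < (mdeg n)./2.+1) alpha R n j.
Definition polyB : {poly R} := \poly_(j < n.+1) beta R n j.

Lemma pn1E x : pn1 n x = polyA.[x ^+ 2].
Proof. by rewrite /pn1 horner_poly; apply: eq_bigr => j _; rewrite exprM. Qed.

Lemma pn2E x : pn2 n x = polyB.[x ^+ 2].
Proof. by rewrite /pn2 horner_poly; apply: eq_bigr => j _; rewrite exprM. Qed.

Lemma mdegE : mdeg n = (mdeg n)./2.*2.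
Proof. by rewrite /mdeg; case: ifP => on; lia. Qed.

(** Coefficient j below the top is the recursion for alpha_(2j), where (2j+2)/2 = j+1; the top one
    is the initial value. *)
Lemma polyA_eq : polyA^`() - 1 *: polyA = (4 / pi) *: even_poly quadA.
Proof.
apply/polyP => j; rewrite scale1r coefB coef_deriv !coef_poly coefZ.
rewrite coef_even_poly coef_quadA !ltnS.
(* [mdeg n] is the largest even number up to n, so both cutoffs agree. *)
have -> : (j.*2 <= n)%N = (j <= (mdeg n)./2)%N by rewrite /mdeg; case: ifP => on; lia.
case: (ltngtP j (mdeg n)./2) => jM.
- rewrite {2}/alpha (_ : (mdeg n)./2 - j = ((mdeg n)./2 - j.+1).+1)%N; last by lia.
  rewrite /= -/(alpha R n j.+1).
  have -> : (mdeg n - 2 * ((mdeg n)./2 - j.+1) = j.+1.*2)%N by have := mdegE; lia.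
  have -> : (mdeg n - 2 * ((mdeg n)./2 - j.+1).+1 = j.*2)%N by have := mdegE; lia.
  rewrite -muln2 natrM -mulr_natr; move: pi^-1 => q; by field.
- by rewrite mul0rn subrr mulr0.
- rewrite mul0rn sub0r /alpha {1}jM subnn /= {1 2}mdegE -jM; ring.
Qed.

(** This is twice the recursion for beta, which turns its 2/pi into 4/pi. *)
Lemma polyB_eq : polyB^`() - 2 *: polyB = (4 / pi) *: even_poly quadB.
Proof.
apply/polyP => j; rewrite coefB coef_deriv coefZ !coef_poly coefZ.
rewrite coef_even_poly !ltnS.
case: (ltngtP j n) => jn.
- rewrite quadB_even 1?ltnW// {2}/beta (_ : n - j = (n - j.+1).+1)%N; last by lia.
  rewrite /= -/(beta R n j.+1) subKn// -mulr_natr; move: pi^-1 => q; by field.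
- rewrite mul0rn mulr0 subrr coef_quadB big1 ?mulr0// => k kj.
  by rewrite /acoef hp_gt ?mulr0//; have := ltn_ord k; lia.
- rewrite mul0rn sub0r jn quadB_even// subnn /betaSum /= subn0 muln0 subn0.
  rewrite /beta subnn /= (minn_idPr _) ?leq_pmull// big_nat1.
  by rewrite (_ : 2 * n - n = n)%N; [ring|lia].
Qed.

(* fn n x is convertible to Num.sqrt (Fn x). *)
Definition Fn x : R :=
  pn0 R n + pn1 n x * expR (- x ^+ 2) + pn2 n x * expR (- (2 * x ^+ 2)).

(** The factor 2x of [is_derive_sqr_gauss] supplies the t of [quad_gaussD], and e^(-2x^2) is split
    to leave one e^(-x^2) outside. *)
Lemma is_derive_Fn x :
  is_derive x 1 Fn (8 / pi * expR (- x ^+ 2) * quad n (@gaussD R) x).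
Proof.
have dA := is_derive_sqr_gauss polyA 1 x; have dB := is_derive_sqr_gauss polyB 2 x.
have -> : Fn = cst (pn0 R n) + (fun y => polyA.[y ^+ 2] * expR (- (1 * y ^+ 2)))
    + (fun y => polyB.[y ^+ 2] * expR (- (2 * y ^+ 2))).
  by apply/funext => y; rewrite /Fn !fctE pn1E pn2E mul1r.
apply: is_derive_eq; rewrite polyA_eq polyB_eq !hornerZ.
rewrite -!even_hornerE; [|exact: quadB_odd|exact: quadA_odd].
rewrite quad_gaussD mul1r add0r (_ : - (2 * x ^+ 2) = - x ^+ 2 + - x ^+ 2); last by ring.
by rewrite expRD; ring.
Qed.

Lemma Fn0 : Fn 0 = 0.
Proof.
rewrite /Fn /pn0 pn1E pn2E !expr0n /= mulr0 oppr0 expR0 !mulr1 !horner_coef0.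
by rewrite !coef_poly /=; ring.
Qed.

End Approximant.

(** * Error bound for f_n and uniform convergence *)

Section Convergence.
Variable R : realType.
Implicit Types (x y : R) (m n : nat).

Lemma dist_sqrt_le (a b : R) : 0 <= b ->
  `|Num.sqrt a - Num.sqrt b| <= Num.sqrt `|a - b|.
Proof.
move=> b0; have [a0|/ltW a0] := leP 0 a; last first.
  (* The radicand of f_n may be negative a priori; there [Num.sqrt] is 0 and |a - b| = b - a >=
     b. *)
  rewrite (ler0_sqrtr a0) sub0r normrN ger0_norm ?sqrtr_ge0//.
  by rewrite ler_wsqrtr// distrC ger0_norm; lra.
rewrite -[leLHS]sqrtr_sqr ler_wsqrtr//.
have -> : a - b = (Num.sqrt a - Num.sqrt b) * (Num.sqrt a + Num.sqrt b).
  by rewrite -subr_sqr !sqr_sqrtr.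
rewrite -[leLHS]ger0_norm ?sqr_ge0// expr2 !normrM ler_wpM2l//.
have := sqrtr_ge0 a; have := sqrtr_ge0 b => sb sa.
by rewrite [leRHS]ger0_norm ?addr_ge0// ler_norml; apply/andP; split; lra.
Qed.

(** Truncated exponential series E_m: E_m(y^2) e^(-y^2) has derivative -2 y^(2m+1) e^(-y^2) / m!. *)
Definition expPoly m : {poly R} := \poly_(k < m.+1) k`!%:R^-1.

Lemma expPoly_deriv m :
  (expPoly m)^`() - 1 *: expPoly m = - (m`!%:R^-1 *: 'X^m).
Proof.
apply/polyP => j; rewrite scale1r coefB coef_deriv !coef_poly coefN coefZ coefXn !ltnS.
case: (ltngtP j m) => [jm|jm|->].
- rewrite mulr0 oppr0 -[_ *+ j.+1]mulr_natr factS natrM invfM.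
  by rewrite mulrAC mulVf ?pnatr_eq0// mul1r subrr.
- by rewrite mul0rn mulr0 subrr oppr0.
- by rewrite mul0rn sub0r mulr1.
Qed.

Lemma erfE x : erf x = 2 / Num.sqrt pi * gauss_int x.
Proof. by []. Qed.

Lemma erf_ge0 x : 0 <= erf x.
Proof. by rewrite mulr_ge0 ?gauss_int_ge0 ?divr_ge0 ?sqrtr_ge0. Qed.

Lemma sqr_erf x : erf x ^+ 2 = 4 / pi * gauss_int x ^+ 2.
Proof.
by rewrite erfE !exprMn exprVn sqr_sqrtr ?pi_ge0// -natrX.
Qed.

(* The majorant g below is an antiderivative of
   (8/pi) 4^-(n+1) y^(2n+3) e^(-y^2) / (n+1)!, by expPoly_deriv. *)
Lemma Fn_sqr_erf n x : 0 <= x ->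
  `|Fn n x - erf x ^+ 2| <= 4 / pi / 4 ^+ n.+1.
Proof.
move=> x0; set c : R := 4 / pi / 4 ^+ n.+1.
have c0 : 0 <= c by rewrite !divr_ge0 ?pi_ge0 ?exprn_ge0.
pose D y := Fn n y - 4 / pi * gauss_int y ^+ 2.
pose g y : R := - c * ((expPoly n.+1).[y ^+ 2] * expR (- (1 * y ^+ 2))).
pose g' y : R := - c * (2 * y * ((expPoly n.+1)^`() - 1 *: expPoly n.+1).[y ^+ 2]
  * expR (- (1 * y ^+ 2))).
have dg y : is_derive y 1 g (g' y).
  have dE := is_derive_sqr_gauss (expPoly n.+1) 1 y.
  exact: (@is_deriveZ _ _ _ _ (- c)).
have DE : D = Fn n - (4 / pi) \*: (@gauss_int R ^+ 2).
  by apply/funext => y; rewrite /D !fctE.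
have D0 : D 0 = 0 by rewrite /D Fn0 gauss_int0 expr0n /= mulr0 subrr.
have : `|D x - D 0| <= g x - g 0.
  apply: (@norm_increment_le _ D g
    (fun y => 8 / pi * expR (- y ^+ 2) * (quad n (@gaussD R) y - gauss_int y)) g') => //.
  - rewrite DE => y; apply: cvgB.
      exact: (derive_within_continuous (A := `[0, x]) (is_derive_Fn n)).
    apply: cvgZ; first exact: cvg_cst.
    have cG := gauss_int_continuous x0 (x := y).
    exact: (cvgM cG cG).
  - exact: derive_within_continuous dg.
  - move=> y /andP[y0 _].
    have dF := is_derive_Fn n y; have dG := is_derive_gauss_int y0.
    rewrite DE; apply: is_derive_eq.
    by rewrite /gaussD hornerC mul1r /GRing.scale /=; ring.
  - move=> y /andP[/ltW y0 _].
    rewrite normrM ger0_norm; last by rewrite mulr_ge0 ?expR_ge0 ?divr_ge0 ?pi_ge0.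
    rewrite distrC /g' expPoly_deriv.
    apply: le_trans (ler_wpM2l _ (gauss_int_quad n y0)) _.
      by rewrite mulr_ge0 ?expR_ge0 ?divr_ge0 ?pi_ge0.
    (* The constant c is chosen so that both sides are equal. *)
    rewrite hornerN hornerZ hornerXn mul1r /c expr_div_n le_eqVlt; apply/orP; left.
    by apply/eqP; rewrite !exprS; ring.
rewrite D0 subr0 /D sqr_erf => /le_trans; apply.
(* Here -g(0) = c, and g(x) <= 0 because [expPoly] has nonnegative coefficients. *)
rewrite /g expr0n mulr0 oppr0 expR0 mulr1 horner_coef0 coef_poly /= fact0 invr1 mulr1.
rewrite opprK gerDr mulNr oppr_le0 mulr_ge0// mulr_ge0 ?expR_ge0//.
rewrite horner_poly sumr_ge0// => k _.
by rewrite mulr_ge0 ?invr_ge0 ?exprn_ge0 ?sqr_ge0.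
Qed.

(** One factor 4 cancels in [Fn_sqr_erf], leaving (1/pi) 4^-n <= (2^-n)^2 under the square root. The
    bound is free of x, hence uniform. *)
Lemma fn_erf_le n x : 0 <= x -> `|fn n x - erf x| <= 2^-1 ^+ n.
Proof.
rewrite (_ : fn n x = Num.sqrt (Fn n x))//.
move=> x0; rewrite -[erf x]ger0_norm ?erf_ge0// -[`|erf x|]sqrtr_sqr.
apply: le_trans (dist_sqrt_le _ (sqr_ge0 _)) _.
have h : 0 <= 2^-1 ^+ n :> R by rewrite exprn_ge0.
rewrite -[leRHS](ger0_norm h) -[leRHS]sqrtr_sqr ler_wsqrtr//.
apply: le_trans (Fn_sqr_erf n x0) _.
rewrite exprS invfM mulrA -exprM mulnC exprM -[leRHS]mul1r.
have -> : (4 ^+ n)^-1 = (2^-1 ^+ 2) ^+ n :> R.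
  by rewrite -exprVn; congr (_ ^+ n); field.
rewrite ler_wpM2r ?exprn_ge0 ?sqr_ge0//.
have p1 : 1 <= pi :> R by apply: le_trans (pi_ge2 R); rewrite ler1n.
by rewrite mulrAC mulfV// mul1r invf_le1// (lt_le_trans ltr01).
Qed.

End Convergence.
Unset Implicit Arguments.

Theorem theorem6p1 (R : realType) :
  (forall x : R, 0 <= x -> fn n x @[n --> \oo] --> erf x) /\
  (forall eps : R, 0 < eps -> exists N : nat, forall n : nat, (N <= n)%N ->
     forall x : R, 0 <= x -> `| fn n x - erf x | < eps).
Proof.
have unif (eps : R) : 0 < eps -> exists N : nat, forall n : nat, (N <= n)%N ->
    forall x : R, 0 <= x -> `| fn n x - erf x | < eps.
  move=> e0; have h : `|2^-1 : R| < 1 by rewrite ger0_norm// invf_lt1// ltr1n.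
  have /cvgrPdist_lt/(_ _ e0)[N _ HN] := cvg_expr h.
  exists N => n Nn x x0; apply: le_lt_trans (fn_erf_le n x0) _.
  by have := HN n Nn; rewrite /= sub0r normrN ger0_norm ?exprn_ge0.
split=> // x x0; apply/cvgrPdist_lt => eps /unif[N HN].
by exists N => // n /= Nn; rewrite distrC; exact: HN.
Qed.
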